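(* For any finite nonempty set $A\subseteq\mathbb{N}$, either $$h(A)\ge\frac{8}{7},$$ or $A$ is of the form $\{a\}$ or $\{a,2a\}$ for some $a\in\mathbb{N}$.
   Context: $\mathbb{N}=\{1,2,3,\dots\}$ and $[n]=\{1,2,\dots,n\}$. For finite $A,B\subseteq\mathbb{N}$, $A\ast B$ is the set of $x\in\mathbb{N}$ for which the number of pairs $(a,b)\in A\times B$ with $ab=x$ is odd. For a finite set $A=\{a_1<\cdots<a_k\}\subseteq\mathbb{N}$, $$h(A)=\sum_{r=1}^{k}\ \sum_{1\le i_1<\cdots<i_r\le k}(-2)^{r-1}\frac{a_{i_1}}{[a_{i_1},\dots,a_{i_r}]},$$ where $[\cdot,\dots,\cdot]$ denotes the least common multiple; equivalently, $h(A)=\lim_{n\to\infty}|A\ast[n]|/n$ (the limit exists). *)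

(* Defs.v *)
From mathcomp Require Import all_boot all_order all_algebra.
From mathcomp Require Import finmap.

Set Implicit Arguments.
Unset Strict Implicit.
Unset Printing Implicit Defensive.

Local Open Scope ring_scope.
Local Open Scope fset_scope.

(* 0 when B is empty *)
Definition fset_min (B : {fset nat}) : nat := head 0%N (sort leq B).

Definition fset_lcm (B : {fset nat}) : nat := (\big[lcmn/1]_(b <- B) b)%N.

(* A choice of indices i_1 < ... < i_r is the choice of the r-element subset
   B = {a_(i_1), ..., a_(i_r)} of A, and then a_(i_1) is the minimum of B. *)
Definition h (A : {fset nat}) : rat :=
  \sum_(1 <= r < #|` A|.+1)
    \sum_(B <- fpowerset A | #|` B| == r)
      (-2) ^+ r.-1 * ((fset_min B)%:R / (fset_lcm B)%:R).

(* Main.v *)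
Require Import Defs.
From mathcomp Require Import all_boot all_order all_algebra.
From mathcomp Require Import finmap.
From mathcomp Require Import zify ring lra.
Import Order.TTheory GRing.Theory Num.Theory.

Local Open Scope fset_scope.
Local Open Scope ring_scope.

(** Write delta(S) for the density of the integers divisible by an odd number of
    elements of S (density below).  Expanding the parity indicator of each
    integer by inclusion-exclusion, and writing the minimum of B as the number
    of t >= 1 that are at most all elements of B, gives
    h(A) = delta(A_1) + delta(A_2) + ... + delta(A_M), where M = max A and A_t is
    the set of the elements of A that are at least t (h_sum_density).

    The function delta is bounded below one prime at a time.  Let p be prime, let
    S0 be the set of elements of S prime to p and W the set of multiples of p in
    S.  Only multiples of p see W, and among the integers seen by S0 the multiples
    of p have proportion 1/p, so deleting the overlap twice gives
    delta(S) >= (1 - 2/p) delta(S0) + delta(W) (density_prime_split).  Together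
    with delta(cS) = delta(S) / c, induction on the primes involved gives
    delta(S) >= 1 / max S (density_lower_bound).  It also gives the gap
    delta(S) >= (4/3) / max S when S is not of the form {a} or {a, 2a}
    (density_gap): if S0 and W are both nonempty for an odd p, then the bound just
    mentioned yields max S * delta(S) >= (1 - 2/p) + 1 >= 4/3; otherwise S is a
    dilate of a set of powers of 2 that contains 1 and is not {1} or {1, 2}, so
    that its maximum is at least 3, and the odd integers alone have density 1/2.

    Suppose finally that A is not of the form {a} or {a, 2a}.  Let b + 1 be
    the least index t for which A_t is of that form, and put r = b / M; then b is
    in A, since A_b and A_(b+1) differ.  The terms with t > b contribute at
    least (M - b) / M = 1 - r.  Each term with t <= b is at least (4/3) / M by the
    gap.  It is also at least 1/b - 1/M (density_split_ge), since
    A_t is the union of a set of maximum b and of the set A_(b+1), whose density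
    is exactly 1/M.  Therefore h(A) >= 1 + r/3 and h(A) >= 2 - 2r, and the
    two bounds cross at r = 3/7, where they equal 8/7. *)

(** * Means over a period *)

Definition mean (N : nat) (F : nat -> rat) : rat :=
  (\sum_(0 <= x < N) F x) / N%:R.

Lemma mean_periodic (N k : nat) (F : nat -> rat) :
  (forall x, F (N + x)%N = F x) -> (0 < k)%N -> mean (k * N) F = mean N F.
Proof.
move=> per k_gt0.
have per_mul j x : F (j * N + x)%N = F x.
  by elim: j => [|j IHj]; rewrite ?mul0n ?add0n // mulSn -addnA per.
have -> : mean (k * N) F = (k%:R * \sum_(0 <= x < N) F x) / (k * N)%:R.
  congr (_ / _); elim: k {k_gt0} => [|k IHk]; first by rewrite mul0n big_geq ?mul0r.
  rewrite mulSnr (big_cat_nat (n := (k * N)%N)) ?leq_addr //= IHk.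
  rewrite -{1}[(k * N)%N]add0n big_addn addKn.
  under [X in _ + X]eq_bigr => x _ do rewrite addnC per_mul.
  by rewrite mulrS mulrDl mul1r addrC.
have k_neq0 : k%:R != 0 :> rat by rewrite pnatr_eq0 -lt0n.
by rewrite /mean natrM -mulf_div divff // mul1r.
Qed.

(** This turns every question about the multiples of p into one about all
    integers: it gives the density of the multiples of a number, the effect of a
    dilation, and the size of the overlap at a prime. *)
Lemma mean_multiples (p N : nat) (F : nat -> rat) : (0 < p)%N ->
  mean (p * N) (fun x => (p %| x)%:R * F x) = mean N (fun x => F (p * x)%N) / p%:R.
Proof.
move=> p_gt0; rewrite /mean natrM invfM mulrCA mulrA [LHS]mulrC mulrA.
rewrite [LHS]mulrC -[RHS]mulrA [RHS]mulrCA [LHS]mulrCA; congr (_ * (_ * _)).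
elim: N => [|N IHN]; first by rewrite muln0 !big_geq.
rewrite mulnSr (big_cat_nat (n := (p * N)%N)) ?leq_addr //= IHN big_nat_recr //=.
congr (_ + _); rewrite big_ltn; last by lia.
rewrite dvdn_mulr // mul1r big1_seq ?addr0 // => x /andP [_].
rewrite mem_index_iota => /andP [lo hi].
suff /negbTE -> : ~~ (p %| x)%N by rewrite mul0r.
apply/negP => /dvdnP [q xE]; move: lo hi; rewrite xE [(q * p)%N]mulnC -mulnSr.
by rewrite !ltn_pmul2l // ltnS => /leq_trans h/h; rewrite ltnn.
Qed.

Lemma ler_mean (N : nat) (F G : nat -> rat) :
  (forall x, F x <= G x) -> mean N F <= mean N G.
Proof.
move=> leFG; rewrite /mean ler_wpM2r ?invr_ge0 ?ler0n //.
by apply: ler_sum => x _; apply: leFG.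
Qed.

Lemma meanD (N : nat) (F G : nat -> rat) :
  mean N (fun x => F x + G x) = mean N F + mean N G.
Proof. by rewrite /mean big_split mulrDl. Qed.

Lemma meanZ (N : nat) (c : rat) (F : nat -> rat) :
  mean N (fun x => c * F x) = c * mean N F.
Proof. by rewrite /mean -mulr_sumr mulrA. Qed.

Lemma mean_sum (I : Type) (r : seq I) (N : nat) (F : I -> nat -> rat) :
  mean N (fun x => \sum_(i <- r) F i x) = \sum_(i <- r) mean N (F i).
Proof. by rewrite /mean exchange_big mulr_suml. Qed.

Lemma eq_mean (N : nat) (F G : nat -> rat) : F =1 G -> mean N F = mean N G.
Proof. by move=> eqFG; rewrite /mean; under eq_bigr do rewrite eqFG. Qed.

Lemma mean_dvdn (d N : nat) : (0 < N)%N -> (d %| N)%N ->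
  mean N (fun x => (d %| x)%:R) = d%:R^-1.
Proof.
move=> N_gt0 /dvdnP [k NE].
have d_gt0 : (0 < d)%N by move: N_gt0; rewrite NE muln_gt0 => /andP [].
have k_gt0 : (0 < k)%N by move: N_gt0; rewrite NE muln_gt0 => /andP [].
under eq_mean => x do rewrite -[_%:R]mulr1.
rewrite NE mulnC mean_multiples // /mean sumr_const_nat subn0 divff ?mul1r //.
by rewrite pnatr_eq0 -lt0n.
Qed.

(** * The density of the integers with an odd number of divisors in S *)

Definition sift (P : pred nat) (S : {fset nat}) : {fset nat} := [fset s in S | P s].

Lemma in_sift (P : pred nat) (S : {fset nat}) (s : nat) :
  (s \in sift P S) = (s \in S) && P s.
Proof. by rewrite !inE. Qed.

Definition oddly_divided (S : {fset nat}) (x : nat) : bool :=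
  \big[addb/false]_(s <- S) (s %| x)%N.

(** The parity has period lcm S, so its mean over one period is its natural
    density. *)
Definition density (S : {fset nat}) : rat :=
  mean (fset_lcm S) (fun x => (oddly_divided S x)%:R).

Lemma dvdn_fset_lcm (S : {fset nat}) (n : nat) :
  (fset_lcm S %| n)%N = all (fun s => s %| n)%N S.
Proof.
rewrite /fset_lcm; elim: (enum_fset S) => [|s r IHr]; first by rewrite big_nil dvd1n.
by rewrite big_cons dvdn_lcm IHr.
Qed.

Lemma fset_lcm_gt0 (S : {fset nat}) :
  {in S, forall s, 0 < s}%N -> (0 < fset_lcm S)%N.
Proof.
by move=> S_pos; rewrite /fset_lcm big_seq; elim/big_rec: _ => // s n /S_pos s0 n0;
  rewrite lcmn_gt0 s0.
Qed.

(** Densities of several sets are compared by passing to one common period. *)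
Lemma densityE (N : nat) (S : {fset nat}) :
  (0 < N)%N -> {in S, forall s, s %| N}%N ->
  density S = mean N (fun x => (oddly_divided S x)%:R).
Proof.
move=> N_gt0 S_dvd.
have /dvdnP [k NE] : (fset_lcm S %| N)%N by rewrite dvdn_fset_lcm; apply/allP.
have k_gt0 : (0 < k)%N by move: N_gt0; rewrite NE muln_gt0 => /andP [].
rewrite NE mean_periodic // => x; congr (_%:R).
congr (nat_of_bool _); apply: eq_big_seq => s sS.
rewrite dvdn_addr //; have := dvdnn (fset_lcm S).
by rewrite dvdn_fset_lcm => /allP; apply.
Qed.

Lemma density_ge0 (S : {fset nat}) : 0 <= density S.
Proof. by rewrite /density /mean divr_ge0 ?sumr_ge0 // => x _; rewrite ler0n. Qed.

Lemma oddly_divided_split (P : pred nat) (S : {fset nat}) (x : nat) :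
  oddly_divided S x =
  oddly_divided (sift P S) x (+) oddly_divided (sift (fun s => ~~ P s) S) x.
Proof. exact: big_fsetID. Qed.

(** Adding to a set new elements of small density cannot destroy much of its
    density: parity is additive, and a xor b >= b - a. *)
Lemma density_split_ge (P : pred nat) (S : {fset nat}) :
  {in S, forall s, 0 < s}%N ->
  density (sift (fun s => ~~ P s) S) - density (sift P S) <= density S.
Proof.
move=> S_pos; have L_gt0 := fset_lcm_gt0 _ S_pos; set L := fset_lcm S in L_gt0.
have L_dvd : {in S, forall s, s %| L}%N by apply/allP; rewrite -dvdn_fset_lcm.
rewrite !(densityE L) // => [|s|s]; try by rewrite in_sift => /andP [/L_dvd].
rewrite -mulN1r -meanZ -meanD; apply: ler_mean => x.
by rewrite (oddly_divided_split P S); do 2 case: oddly_divided.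
Qed.

(** If the elements of S are prime to p, divisibility of p * x by them is the same
    as divisibility of x, so being a multiple of p is independent of S. *)
Lemma mean_oddly_divided_multiples (p N : nat) (S : {fset nat}) :
  prime p -> (0 < N)%N -> {in S, forall s, s %| N /\ ~~ (p %| s)}%N ->
  mean (p * N) (fun x => (p %| x)%:R * (oddly_divided S x)%:R) = density S / p%:R.
Proof.
move=> p_pr N_gt0 S_dvd; rewrite mean_multiples ?prime_gt0 //.
rewrite (densityE N) // => [|s /S_dvd []//]; congr (_ / _); apply: eq_mean => x.
congr (nat_of_bool _)%:R; apply: eq_big_seq => s /S_dvd [_ ps].
by rewrite Gauss_dvdr // coprime_sym prime_coprime.
Qed.

(** Off the multiples of p, the parity of S is that of the part prime to p; this
    gives the second bound.  For the first, a xor b = a + b - 2ab, and the product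
    term lives on the multiples of p, where the part prime to p has only 1/p of
    its density.  The first bound is void on that part for p = 2, hence the
    second. *)
Lemma density_prime_split (p : nat) (S : {fset nat}) :
  prime p -> {in S, forall s, 0 < s}%N ->
  (1 - 2 / p%:R) * density (sift (fun s => ~~ (p %| s)%N) S)
      + density (sift (dvdn p) S) <= density S
  /\ (1 - p%:R^-1) * density (sift (fun s => ~~ (p %| s)%N) S) <= density S.
Proof.
move=> p_pr S_pos.
have L_gt0 := fset_lcm_gt0 _ S_pos; set L := fset_lcm S in L_gt0.
have L_dvd : {in S, forall s, s %| L}%N by apply/allP; rewrite -dvdn_fset_lcm.
set S0 := sift (fun s => ~~ (p %| s)%N) S; set W := sift (dvdn p) S.
have S0_dvd : {in S0, forall s, s %| L /\ ~~ (p %| s)}%N.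
  by move=> s; rewrite in_sift => /andP [/L_dvd].
have overlap := mean_oddly_divided_multiples _ _ _ p_pr L_gt0 S0_dvd.
have W_multiples x : ~~ (p %| x)%N -> ~~ oddly_divided W x.
  move=> px; rewrite /oddly_divided big1_seq // => s /andP [_].
  rewrite in_sift => /andP [_ ps]; apply: contraNF px; exact: dvdn_trans.
have pL_dvd : {in S, forall s, s %| p * L}%N by move=> s /L_dvd; apply: dvdn_mull.
have S_split x := oddly_divided_split (dvdn p) S x.
have pL_gt0 : (0 < p * L)%N by rewrite muln_gt0 prime_gt0.
have -> : (1 - 2 / p%:R) * density S0 + density W
    = density S0 + density W + (-2) * (density S0 / p%:R) by ring.
have -> : (1 - p%:R^-1) * density S0 = density S0 + (-1) * (density S0 / p%:R) by ring.
rewrite -overlap !(densityE (p * L)%N) //;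
  try by [move=> s; rewrite in_sift => /andP [/pL_dvd] | move=> s /S0_dvd [? _]; apply: dvdn_mull].
rewrite -!meanZ -!meanD; split; apply: ler_mean => x;
  rewrite S_split -/S0 -/W; move: (W_multiples x);
  by case: (p %| x)%N; do 2 case: oddly_divided => //=; move=> /(_ isT).
Qed.

Definition dilate (c : nat) (S : {fset nat}) : {fset nat} := [fset (c * s)%N | s in S].

Lemma density_dilate (c : nat) (S : {fset nat}) :
  (0 < c)%N -> {in S, forall s, 0 < s}%N ->
  density (dilate c S) = density S / c%:R.
Proof.
move=> c_gt0 S_pos; have L_gt0 := fset_lcm_gt0 _ S_pos; set L := fset_lcm S in L_gt0.
have L_dvd : {in S, forall s, s %| L}%N by apply/allP; rewrite -dvdn_fset_lcm.
rewrite (densityE L S) // (densityE (c * L)%N) ?muln_gt0 ?c_gt0 //; last first.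
  by move=> _ /imfsetP [s /= /L_dvd sL ->]; rewrite dvdn_pmul2l.
have oddE x : oddly_divided (dilate c S) (c * x) = oddly_divided S x.
  rewrite /oddly_divided big_imfset /=; last first.
    by move=> s t _ _ /eqP; rewrite eqn_pmul2l // => /eqP.
  by apply: eq_bigr => s _; rewrite dvdn_pmul2l.
have -> : mean L (fun x => (oddly_divided S x)%:R)
    = mean L (fun x => (oddly_divided (dilate c S) (c * x))%:R).
  by apply: eq_mean => x; rewrite oddE.
rewrite -(mean_multiples _ _ (fun x => (oddly_divided (dilate c S) x)%:R)) //.
apply: eq_mean => x.
have [cx|cx] := boolP (c %| x)%N; first by rewrite mul1r.
rewrite mul0r /oddly_divided big1_seq // => _ /andP [_ /imfsetP [s /= _ ->]].
by apply: contraNF cx; apply: dvdn_trans; apply: dvdn_mulr.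
Qed.

Lemma multiplesE (p : nat) (S : {fset nat}) : (0 < p)%N ->
  {in S, forall s, p %| s}%N -> exists V, S = dilate p V.
Proof.
move=> p_gt0 S_mul; exists [fset (s %/ p)%N | s in S]; apply/fsetP => s.
apply/idP/imfsetP => /= [sS|[_ /imfsetP [t /= tS ->] ->]].
  by exists (s %/ p)%N; [apply/imfsetP; exists s | rewrite mulnC divnK ?S_mul].
by rewrite mulnC divnK ?S_mul.
Qed.

Lemma dilate_gt0 (c : nat) (S : {fset nat}) :
  {in dilate c S, forall s, 0 < s}%N -> {in S, forall s, 0 < s}%N.
Proof.
move=> cS_pos s sS; have := cS_pos (c * s)%N; rewrite in_imfset //.
by move=> /(_ isT); rewrite muln_gt0 => /andP [].
Qed.

Lemma density_singleton (d : nat) : (0 < d)%N -> density [fset d] = d%:R^-1.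
Proof.
move=> d_gt0; rewrite (densityE d) // => [|s]; last by rewrite inE => /eqP ->.
by rewrite -[RHS](mean_dvdn d d) //; apply: eq_mean => x; rewrite /oddly_divided big_seq_fset1.
Qed.

(** * Lower bounds by induction on primes *)

(** The induction runs over a common multiple n of S and splits S at the largest
    prime p dividing n.  If all elements of S are prime to p, or all are multiples
    of p, then S or S / p consists of divisors of n / p; otherwise both parts of S
    are reached.  Taking the largest prime ensures that p = 2 is met only when S
    consists of powers of 2. *)
Lemma prime_split_ind (P : {fset nat} -> Prop) :
  P [fset 1%N] ->
  (forall p V, prime p -> V != fset0 -> {in V, forall v, 0 < v}%N -> P V ->
     P (dilate p V)) ->
  (forall p S, prime p -> {in S, forall s, 0 < s}%N ->
     {in S, forall s q, prime q -> q %| s -> q <= p}%N ->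
     (sift (fun s => ~~ (p %| s)%N) S) != fset0 -> P (sift (fun s => ~~ (p %| s)%N) S) ->
     (sift (dvdn p) S) != fset0 -> P (sift (dvdn p) S) ->
     P S) ->
  forall S, S != fset0 -> {in S, forall s, 0 < s}%N -> P S.
Proof.
move=> P1 P_dilate P_split S S_neq0 S_pos.
have L_dvd : {in S, forall s, s %| fset_lcm S}%N by apply/allP; rewrite -dvdn_fset_lcm.
move: (fset_lcm S) (fset_lcm_gt0 _ S_pos) L_dvd => n.
elim/ltn_ind: n S S_neq0 S_pos => n IHn S S_neq0 S_pos n_gt0 S_dvd.
case: (ltngtP n 1%N) => [|n_gt1|n1]; first by rewrite ltnNge n_gt0.
  pose p := max_pdiv n; have p_pr : prime p by apply: max_pdiv_prime.
  have /dvdnP [m nE] : (p %| n)%N by apply: max_pdiv_dvd.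
  have m_gt0 : (0 < m)%N by move: n_gt0; rewrite nE muln_gt0 => /andP [].
  have lt_mn : (m < n)%N by rewrite nE ltn_Pmulr ?prime_gt1.
  set S0 := sift (fun s => ~~ (p %| s)%N) S; set W := sift (dvdn p) S.
  have S0_dvd : {in S0, forall s, s %| m}%N.
    move=> s; rewrite in_sift => /andP [/S_dvd]; rewrite nE => + ps.
    by rewrite Gauss_dvdl // coprime_sym prime_coprime.
  have [S0E|S0_neq0] := eqVneq S0 fset0; last have P_S0 : P S0.
  - have S_mul : {in S, forall s, p %| s}%N.
      move=> s sS; apply: contraT => ps; suff : s \in S0 by rewrite S0E.
      by rewrite in_sift sS.
    have [V SE] := multiplesE _ _ (prime_gt0 p_pr) S_mul.
    have V_pos : {in V, forall v, 0 < v}%N by apply: (dilate_gt0 p); rewrite -SE.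
    have V_neq0 : V != fset0.
      by apply: contraNneq S_neq0 => V0; rewrite SE V0 /dilate imfset0.
    rewrite SE; apply: P_dilate => //; apply: (IHn m) => // v vV.
    rewrite -(dvdn_pmul2l (prime_gt0 p_pr)) [(p * m)%N]mulnC -nE; apply: S_dvd.
    by rewrite SE in_imfset.
  - by apply: (IHn m) => // s; rewrite in_sift => /andP [/S_pos].
  have [WE|W_neq0] := eqVneq W fset0.
    suff -> : S = S0 by [].
    apply/fsetP => s; rewrite in_sift; have [sS|] //= := boolP (s \in S).
    by apply/esym/negP => ps; have : s \in W by [rewrite in_sift sS]; rewrite WE.
  apply: (P_split p S p_pr S_pos _ S0_neq0 P_S0 W_neq0).
    move=> s /S_dvd sn q q_pr qs; apply: max_pdiv_max; rewrite mem_primes q_pr n_gt0.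
    exact: dvdn_trans sn.
  have W_mul : {in W, forall s, p %| s}%N by move=> s; rewrite in_sift => /andP [].
  have [V WE] := multiplesE _ _ (prime_gt0 p_pr) W_mul.
  have V_pos : {in V, forall v, 0 < v}%N.
    by apply: (dilate_gt0 p); rewrite -WE => s; rewrite in_sift => /andP [/S_pos].
  have V_neq0 : V != fset0.
    by apply: contraNneq W_neq0 => V0; rewrite WE V0 /dilate imfset0.
  rewrite -/W WE; apply: P_dilate => //; apply: (IHn m) => // v vV.
  rewrite -(dvdn_pmul2l (prime_gt0 p_pr)) [(p * m)%N]mulnC -nE; apply: S_dvd.
  suff : (p * v)%N \in W by rewrite in_sift => /andP [].
  by rewrite WE in_imfset.
suff -> : S = [fset 1%N] by [].
have S1 : {in S, forall s, s = 1%N}.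
  by move=> s /S_dvd; rewrite n1 dvdn1 => /eqP.
have [s sS] := fset0Pn _ S_neq0; apply/fsetP => t; rewrite inE.
by apply/idP/eqP => [/S1|-> //]; rewrite -(S1 s).
Qed.

Lemma bound_ge0 (S : {fset nat}) (M : rat) :
  S != fset0 -> {in S, forall s, s%:R <= M} -> 0 <= M.
Proof. by move=> /fset0Pn [s sS] /(_ s sS); apply: le_trans. Qed.

Lemma bound_dilate (p : nat) (V : {fset nat}) (M : rat) : (0 < p)%N ->
  {in dilate p V, forall s, s%:R <= M} -> {in V, forall v, v%:R <= M / p%:R}.
Proof.
move=> p_gt0 pV_M v vV; rewrite ler_pdivlMr ?ltr0n // mulrC -natrM.
by apply: pV_M; rewrite in_imfset.
Qed.

Lemma bound_sift (P : pred nat) (S : {fset nat}) (M : rat) :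
  {in S, forall s, s%:R <= M} -> {in sift P S, forall s, s%:R <= M}.
Proof. by move=> S_M s; rewrite in_sift => /andP [/S_M]. Qed.

(** The bound M is rational so that it can be divided by p when a dilation by p is
    undone. *)
Lemma density_lower_bound (S : {fset nat}) (M : rat) :
  S != fset0 -> {in S, forall s, 0 < s}%N -> {in S, forall s, s%:R <= M} ->
  1 <= M * density S.
Proof.
move=> S_neq0 S_pos; move: S S_neq0 S_pos M; apply: prime_split_ind.
- by move=> M /(_ 1%N); rewrite density_singleton // invr1 mulr1 => -> //; rewrite inE.
- move=> p V p_pr V_neq0 V_pos IH M M_bd; have p_gt0 := prime_gt0 p_pr.
  rewrite density_dilate // mulrA mulrAC; apply: IH; exact: bound_dilate.
move=> p S p_pr S_pos _ S0_neq0 _ W_neq0 IH M M_bd.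
have [le_split _] := density_prime_split p S p_pr S_pos.
have M_ge0 := bound_ge0 _ _ W_neq0 (bound_sift _ _ _ M_bd).
have p_ge2 : 2 / p%:R <= 1 :> rat.
  by rewrite ler_pdivrMr ?ltr0n ?prime_gt0 // mul1r ler_nat prime_gt1.
apply: le_trans (ler_wpM2l M_ge0 le_split).
apply: le_trans (IH M (bound_sift _ _ _ M_bd)) _; rewrite ler_wpM2l // lerDr.
by rewrite mulr_ge0 ?density_ge0 // subr_ge0.
Qed.

Definition exceptional (S : {fset nat}) : bool :=
  has (fun a => (S == [fset a]) || (S == [fset a; (2 * a)%N])) S.

Lemma exceptionalP (S : {fset nat}) :
  reflect (exists a, S = [fset a] \/ S = [fset a; (2 * a)%N]) (exceptional S).
Proof.
apply: (iffP hasP) => [[a _ /orP [] /eqP]|[a SE]]; [by exists a; left|by exists a; right|].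
by exists a; case: SE => ->; rewrite ?inE ?eqxx ?orbT.
Qed.

Lemma density_exceptional (S : {fset nat}) (M : nat) :
  exceptional S -> (0 < M)%N -> M \in S -> {in S, forall s, s <= M}%N ->
  density S = M%:R^-1.
Proof.
move=> /exceptionalP [a [] ->] M_gt0; rewrite !inE.
  by move=> /eqP <- _; apply: density_singleton.
move=> MS /(_ (2 * a)%N); rewrite !inE eqxx orbT => /(_ isT) leM.
have {MS} ME : (M = a * 2)%N by case/orP: MS => /eqP; lia.
have a_gt0 : (0 < a)%N by lia.
have -> : [fset a; (2 * a)%N] = dilate a [fset 1%N; 2%N].
  apply/fsetP => s; rewrite !inE; apply/orP/imfsetP => /= [|[t]].
    by case=> /eqP ->; [exists 1%N|exists 2%N]; rewrite ?inE ?muln1 // mulnC.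
  by rewrite !inE => /orP [] /eqP -> ->; rewrite ?muln1 ?[(a * _)%N]mulnC eqxx; [left|right].
rewrite density_dilate // => [|s]; last by rewrite !inE => /orP [] /eqP ->.
rewrite (densityE 2) // => [|s]; last by rewrite !inE => /orP [] /eqP ->.
rewrite /mean big_nat_recr // big_nat1 /oddly_divided !big_fsetU1 ?inE //= !big_seq_fset1.
by rewrite ME natrM invfM mulrC /= add0r mul1r.
Qed.

Lemma exceptional_dilate (c : nat) (S : {fset nat}) :
  exceptional S -> exceptional (dilate c S).
Proof.
move=> /exceptionalP [a SE]; apply/exceptionalP; exists (c * a)%N.
case: SE => ->; [left|right]; first by rewrite /dilate imfset_fset1.
apply/fsetP => s; rewrite !inE; apply/imfsetP/orP => /= [[t]|].
  by rewrite !inE => /orP [] /eqP -> ->; rewrite mulnCA eqxx; [left|right].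
by case=> /eqP ->; [exists a|exists (2 * a)%N]; rewrite ?inE ?eqxx ?orbT // mulnCA.
Qed.

(** At an odd prime the splitting inequality and the bound 1 for both parts give
    (1 - 2/p) + 1 >= 4/3.  At p = 2 the set consists of powers of 2 and contains
    1; if it is not {1, 2} its maximum is at least 3, while its density is at least
    1/2, that of the odd integers. *)
Lemma density_gap (S : {fset nat}) (M : rat) :
  S != fset0 -> {in S, forall s, 0 < s}%N -> {in S, forall s, s%:R <= M} ->
  ~~ exceptional S -> 4 / 3 <= M * density S.
Proof.
move=> S_neq0 S_pos; move: S S_neq0 S_pos M; apply: prime_split_ind.
- by move=> M _ /exceptionalP []; exists 1%N; left.
- move=> p V p_pr V_neq0 V_pos IH M M_bd ex_pV; have p_gt0 := prime_gt0 p_pr.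
  rewrite density_dilate // mulrA mulrAC; apply: IH; first exact: bound_dilate.
  by apply: contra ex_pV; apply: exceptional_dilate.
move=> p S p_pr S_pos p_max S0_neq0 _ W_neq0 _ M M_bd ex_S.
have [le_split le_split0] := density_prime_split p S p_pr S_pos.
set S0 := sift _ S in S0_neq0 le_split le_split0.
set W := sift _ S in W_neq0 le_split.
have S0_M : {in S0, forall s, s%:R <= M} by apply: bound_sift.
have W_M : {in W, forall s, s%:R <= M} by apply: bound_sift.
have M_ge0 := bound_ge0 _ _ W_neq0 W_M.
have [p2|p_neq2] := eqVneq p 2%N; last first.
  have S0_ge : 1 <= M * density S0.
    by apply: density_lower_bound => // s; rewrite in_sift => /andP [/S_pos].
  have W_ge : 1 <= M * density W.
    by apply: density_lower_bound => // s; rewrite in_sift => /andP [/S_pos].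
  have p_ge3 : 2 / p%:R <= 2 / 3 :> rat.
    rewrite ler_pM2l // lef_pV2 ?posrE ?ltr0n ?prime_gt0 // ler_nat.
    by have := prime_gt1 p_pr; move: p_neq2; clear; lia.
  apply: le_trans (ler_wpM2l M_ge0 le_split); rewrite mulrDr mulrCA.
  have : (1 - 2 / p%:R) * 1 <= (1 - 2 / p%:R) * (M * density S0).
    by rewrite ler_wpM2l //; lra.
  lra.
have S0E : {in S0, forall s, s = 1%N}.
  move=> s; rewrite in_sift => /andP [sS ps]; have s_gt0 := S_pos s sS.
  case: (ltngtP s 1%N) => // [|s_gt1]; first by rewrite ltnNge s_gt0.
  have q_pr := pdiv_prime s_gt1; have qs := pdiv_dvd s.
  have q_le2 := p_max s sS (pdiv s) q_pr qs; have q_gt1 := prime_gt1 q_pr.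
  by case/negP: ps; suff -> : p = pdiv s by []; move: q_le2 q_gt1; rewrite p2; lia.
have S0_1 : S0 = [fset 1%N].
  have [s sS0] := fset0Pn _ S0_neq0; apply/fsetP => t; rewrite inE.
  by apply/idP/eqP => [/S0E|-> //]; rewrite -(S0E s).
have one_S : 1%N \in S.
  suff : 1%N \in S0 by rewrite in_sift => /andP [].
  by rewrite S0_1 inE.
have M_ge3 : 3 <= M.
  apply: contraR ex_S; rewrite -ltNge => M_lt3; apply/exceptionalP; exists 1%N; right.
  have S_le2 : {in S, forall s, s <= 2}%N.
    by move=> s /M_bd sM; rewrite -ltnS -(ltr_nat rat); apply: le_lt_trans M_lt3.
  apply/fsetP => s; rewrite !inE; apply/idP/orP => [sS|[] /eqP -> //].
    by have := S_pos s sS; have := S_le2 s sS; case: s {sS} => [|[|[|]]] // _ _; [left|right].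
  have [w] := fset0Pn _ W_neq0; rewrite in_sift p2 => /andP [wS /dvdnP [k wE]].
  suff w2 : w = 2%N by rewrite muln1 -w2.
  by have := S_pos w wS; have := S_le2 w wS; rewrite wE; lia.
move: le_split0; rewrite S0_1 density_singleton // p2 => le_half.
apply: le_trans (ler_wpM2l M_ge0 le_half); lra.
Qed.

(** * The weight h as a sum of densities *)

Lemma prod_1D_fset (S : {fset nat}) (g : nat -> rat) :
  \prod_(s <- S) (1 + g s) = \sum_(B <- fpowerset S) \prod_(b <- B) g b.
Proof.
move: {2}#|` S| (erefl #|` S|) => n; elim: n S => [|n IHn] S cardS.
  by rewrite (cardfs0_eq cardS) fpowerset0 big_seq_fset1 !big_seq_fset0.
have [a aS] : exists a, a \in S by apply/fset0Pn; rewrite -cardfs_gt0 cardS.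
have aSa : a \notin S `\ a by rewrite !inE eqxx.
have cardSa : #|` S `\ a| = n by move: (cardfsD1 a S); rewrite aS cardS => -[].
rewrite (big_fsetD1 a) //= IHn // mulrDl mul1r mulr_sumr.
rewrite [RHS](big_fsetID _ (fun B : {fset nat} => a \notin B)) /=; congr (_ + _).
  by apply: eq_fbigl => B; rewrite !inE !fpowersetE /= fsubsetD1.
have -> : [fset B in fpowerset S | ~~ (a \notin B)]
    = [fset a |` B | B in fpowerset (S `\ a)].
  apply/fsetP => B; rewrite !inE negbK fpowersetE; apply/andP/imfsetP => /= [[BS aB]|].
    by exists (B `\ a); rewrite ?fsetD1K // fpowersetE fsetSD.
  move=> [C + ->]; rewrite fpowersetE fsubsetD1 => /andP [CS _].
  by rewrite fset1U1 fsubUset fsub1set aS.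
rewrite [RHS]big_imfset /=; last first.
  move=> B C; rewrite !fpowersetE !fsubsetD1 => /andP [_ aB] /andP [_ aC] eqBC.
  by rewrite -(fsetU1K aB) eqBC fsetU1K.
rewrite !big_seq; apply: eq_bigr => B; rewrite fpowersetE fsubsetD1 => /andP [_ aB].
by rewrite big_fsetU1.
Qed.

(** Expand the identity 1 - 2 [odd] = (-1)^(number of divisors in S), whose right
    side is the product over s of 1 - 2 [s divides x]. *)
Lemma oddly_divided_sum (S : {fset nat}) (x : nat) :
  (oddly_divided S x)%:R
    = \sum_(B <- fpowerset S | B != fset0)
        (-2) ^+ #|` B|.-1 * (fset_lcm B %| x)%:R :> rat.
Proof.
have sign_odd : 1 - 2 * (oddly_divided S x)%:R
    = \prod_(s <- S) (1 + -2 * (s %| x)%:R) :> rat.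
  rewrite /oddly_divided; elim: (enum_fset S) => [|s r IHr].
    by rewrite !big_nil mulr0 subr0.
  rewrite !big_cons -IHr; case: (s %| x)%N; case: (\big[addb/false]_(j <- r) _) => //=; ring.
have prod_lcm (B : {fset nat}) : \prod_(b <- B) (-2 * (b %| x)%:R)
    = (-2) ^+ #|` B| * (fset_lcm B %| x)%:R :> rat.
  rewrite dvdn_fset_lcm; elim: (enum_fset B) => [|b r IHr].
    by rewrite big_nil mulr1.
  by rewrite big_cons IHr /= exprS; case: (b %| x)%N; rewrite /= ?mulr0 ?mul0r //; ring.
move: sign_odd; rewrite prod_1D_fset.
under eq_bigr do rewrite prod_lcm.
rewrite (bigD1_seq fset0) ?fset_uniq ?fpowersetE ?fsub0set //.
rewrite cardfs0 /fset_lcm big_seq_fset0 dvd1n mulr1 => sumE.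
have -> : (oddly_divided S x)%:R
    = - 2^-1 * ((1 - 2 * (oddly_divided S x)%:R) - 1) :> rat by field.
rewrite sumE expr0 [X in X - 1]addrC addrK mulr_sumr; apply: eq_bigr => B.
by rewrite -cardfs_gt0; case: #|` B| => // c _; rewrite exprS; field.
Qed.

Lemma density_sum (S : {fset nat}) : {in S, forall s, 0 < s}%N ->
  density S = \sum_(B <- fpowerset S | B != fset0)
                (-2) ^+ #|` B|.-1 / (fset_lcm B)%:R.
Proof.
move=> S_pos; rewrite /density.
under eq_mean do rewrite oddly_divided_sum -big_filter.
rewrite mean_sum -[RHS]big_filter big_seq [RHS]big_seq; apply: eq_bigr => B.
rewrite mem_filter fpowersetE => /andP [_ /fsubsetP BS].
rewrite meanZ mean_dvdn ?fset_lcm_gt0 // dvdn_fset_lcm; apply/allP => b /BS bS.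
by have := dvdnn (fset_lcm S); rewrite dvdn_fset_lcm => /allP; apply.
Qed.

Lemma leq_fset_min (B : {fset nat}) (t : nat) : B != fset0 ->
  (t <= fset_min B)%N = all (leq t) B.
Proof.
rewrite -cardfs_gt0 /fset_min => B_gt0.
rewrite -(all_sort (leq t) leq B); have := sort_sorted leq_total B.
have : (0 < size (sort leq B))%N by rewrite size_sort.
case: (sort leq B) => //= m s _ /(order_path_min leq_trans) /allP m_min.
apply/idP/andP => [tm|[]//]; split=> //; apply/allP => b /m_min; exact: leq_trans.
Qed.

(** For nonempty B, the number of t >= 1 with B inside the elements at least t is
    the minimum of B: summing the inclusion-exclusion formulas for these tails
    restores the weight min / lcm of each B. *)
Lemma h_sum_density (A : {fset nat}) (M : nat) :
  {in A, forall a, 0 < a <= M}%N ->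
  h A = \sum_(1 <= t < M.+1) density (sift (leq t) A).
Proof.
move=> A_bd.
have -> : h A = \sum_(B <- fpowerset A | B != fset0)
                  (-2) ^+ #|` B|.-1 * ((fset_min B)%:R / (fset_lcm B)%:R).
  rewrite /h; under eq_bigr do rewrite big_mkcond.
  rewrite exchange_big [RHS]big_mkcond !big_seq; apply: eq_bigr => B.
  rewrite fpowersetE => /fsubset_leq_card cardB /=; rewrite -big_mkcond /=.
  under eq_bigl do rewrite eq_sym.
  by rewrite big_nat1_eq ltnS cardB andbT cardfs_gt0.
have density_t t : density (sift (leq t) A) = \sum_(B <- fpowerset A | B != fset0)
    (t <= fset_min B)%:R * ((-2) ^+ #|` B|.-1 / (fset_lcm B)%:R).
  rewrite density_sum => [|s]; last by rewrite in_sift => /andP [/A_bd /andP []].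
  under [RHS]eq_bigr do rewrite mulr_natl mulrb.
  rewrite -big_mkcondr -[LHS]big_filter -[RHS]big_filter; apply: perm_big.
  apply: uniq_perm; rewrite ?filter_uniq ?fset_uniq // => B.
  rewrite !mem_filter !fpowersetE; have [//|B_neq0] := eqVneq B fset0.
  rewrite leq_fset_min //=; apply/fsubsetP/andP => [BA|[/allP tB /fsubsetP BA] b bB].
    by split; [apply/allP|apply/fsubsetP] => b /BA; rewrite in_sift => /andP [].
  by rewrite in_sift BA //=; apply: tB.
under [RHS]eq_bigr do rewrite density_t.
rewrite exchange_big; rewrite big_seq_cond [RHS]big_seq_cond; apply: eq_bigr => B.
rewrite fpowersetE => /andP [/fsubsetP BA B_neq0].
have minM : (fset_min B <= M)%N.
  have [b bB] := fset0Pn _ B_neq0; have /andP [_ bM] := A_bd b (BA b bB).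
  apply: leq_trans bM; have := leqnn (fset_min B).
  by rewrite leq_fset_min // => /allP; apply.
have -> : (fset_min B)%:R = \sum_(1 <= t < M.+1) (t <= fset_min B)%:R :> rat.
  rewrite (big_cat_nat (n := (fset_min B).+1)) //= [X in _ + X]big1_seq ?addr0.
    under eq_big_nat => t /andP [_] do rewrite ltnS => ->.
    by rewrite sumr_const_nat subn1.
  by move=> t; rewrite mem_index_iota => /andP [_ /andP [+ _]]; rewrite ltnNge => /negbTE ->.
by rewrite -mulr_suml mulrCA.
Qed.

(** * The theorem *)

Theorem theorem1p8 (A : {fset nat})
    (A_pos : forall a : nat, a \in A -> (0 < a)%N)
    (A_neq0 : A != fset0) :
  (8 / 7 : rat) <= h A \/
  exists a : nat, (0 < a)%N /\ (A = [fset a] \/ A = [fset a; (2 * a)%N]).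
Proof.
have [ex_A|ex_A] := boolP (exceptional A).
  right; have /exceptionalP [a AE] := ex_A; exists a; split=> //.
  by apply: A_pos; case: AE => ->; rewrite !inE eqxx.
left.
have [M M_A A_M] : exists2 M, M \in A & {in A, forall a, a <= M}%N.
  have [a0 a0A] := fset0Pn _ A_neq0.
  have le_max a : a \in A -> (a <= \max_(x <- A) x)%N.
    by move=> aA; apply: leq_bigmax_seq.
  by case: (ex_maxnP (ex_intro _ a0 a0A) le_max) => M; exists M.
have M_gt0 := A_pos M M_A.
pose tail t := sift (leq t) A.
have tail_pos t : {in tail t, forall a, 0 < a}%N.
  by move=> a; rewrite in_sift => /andP [/A_pos].
have tail_M t : {in tail t, forall a, a%:R <= M%:R :> rat}.
  by move=> a; rewrite in_sift ler_nat => /andP [/A_M].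
have M_tail t : (t <= M)%N -> M \in tail t by rewrite in_sift M_A.
have tail_neq0 t : (t <= M)%N -> tail t != fset0.
  by move=> tM; apply/fset0Pn; exists M; apply: M_tail.
have ex_tail_M : exceptional (tail M).
  apply/exceptionalP; exists M; left; apply/fsetP => a; rewrite in_sift inE.
  by apply/andP/eqP => [[/A_M aM Ma]|->//]; apply/eqP; rewrite eqn_leq aM.
(* b.+1 is the first index whose tail is exceptional, so the tail at b is not. *)
case: (ex_minnP (ex_intro (fun t => exceptional (tail t)) M ex_tail_M)) => -[|b] ex_b min_b.
  by case/negP: ex_A; congr exceptional: ex_b; apply/fsetP => a; rewrite in_sift andbT.
have lt_bM : (b < M)%N := min_b M ex_tail_M.
have tail_ex t : (t <= b)%N -> ~~ exceptional (tail t).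
  by move=> tb; apply/negP => /min_b; rewrite ltnNge tb.
have b_A : b \in A.
  apply: contraR (tail_ex b (leqnn b)) => bA; congr exceptional: ex_b.
  apply/fsetP => a; rewrite !in_sift ltn_neqAle; case aA : (a \in A) => //=.
  by rewrite (_ : b != a) //; apply: contraNneq bA => ->.
have b_gt0 := A_pos b b_A.
have M_pos : 0 < M%:R :> rat by rewrite ltr0n.
have b_pos : 0 < b%:R :> rat by rewrite ltr0n.
have low t : (t <= M)%N -> M%:R^-1 <= density (tail t).
  move=> tM; rewrite -[_^-1]mulr1 mulrC ler_pdivrMr // mulrC.
  by apply: density_lower_bound; [apply: tail_neq0| |].
have high t : (t <= b)%N -> 4 / 3 / M%:R <= density (tail t).
  move=> tb; rewrite ler_pdivrMr // [_ * M%:R]mulrC; apply: density_gap => //; last exact: tail_ex.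
  by apply: tail_neq0; apply: leq_trans (ltnW lt_bM).
(* Split the tail at t into the elements up to b and the exceptional tail at b.+1. *)
have diff t : (t <= b)%N -> b%:R^-1 - M%:R^-1 <= density (tail t).
  move=> tb.
  have := density_split_ge (fun a => b < a)%N (tail t) (tail_pos t).
  have -> : sift (fun a => b < a)%N (tail t) = tail b.+1.
    apply/fsetP => a; rewrite !in_sift -andbA; congr (_ && _).
    by apply/andP/idP => [[]//|ba]; split=> //; apply: leq_trans (ltnW ba).
  rewrite (density_exceptional (tail b.+1) M) ?M_tail // => [|a]; last first.
    by rewrite in_sift => /andP [/A_M].
  apply: le_trans; rewrite lerB // -[_^-1]mulr1 mulrC ler_pdivrMr // mulrC.
  apply: density_lower_bound.
  - by apply/fset0Pn; exists b; rewrite !in_sift b_A tb ltnn.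
  - by move=> a; rewrite in_sift => /andP [/tail_pos].
  - by move=> a; rewrite in_sift -leqNgt ler_nat => /andP [].
have A_bd : {in A, forall a, 0 < a <= M}%N by move=> a aA; rewrite A_pos // A_M.
have h_ge c : (forall t, (t <= b)%N -> c <= density (tail t)) ->
    b%:R * c + (M%:R - b%:R) / M%:R <= h A.
  move=> c_le; rewrite (h_sum_density _ _ A_bd) (big_cat_nat (n := b.+1)) //=; last first.
    exact: ltnW.
  apply: lerD.
    rewrite mulr_natl -[X in _ *+ X](subn1 b.+1) -sumr_const_nat.
    by rewrite !big_nat; apply: ler_sum => t /andP [_]; rewrite ltnS => /c_le.
  rewrite -natrB 1?ltnW // -subSS mulr_natl -sumr_const_nat !big_nat.
  by apply: ler_sum => t /andP [_]; rewrite ltnS => /low.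
set r := b%:R / M%:R : rat.
have h_ge_r : 1 + r / 3 <= h A.
  apply: le_trans (h_ge _ high); rewrite le_eqVlt; apply/orP; left; apply/eqP.
  by rewrite /r; field; lra.
have h_ge_1r : 2 - 2 * r <= h A.
  apply: le_trans (h_ge _ diff); rewrite le_eqVlt; apply/orP; left; apply/eqP.
  by rewrite /r; field; lra.
lra.
Qed.
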